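(* Let $P_n$ denote the Legendre polynomial of degree $n$. The inequality $$\frac{P_{n-1}(x)\,P_{n+1}(x)}{P_n^2(x)}\leq\frac{(n+1)^2}{n(n+2)}\quad\text{for all real }|x|>1$$ holds for every integer $n\geq2$, with equality if and only if $n=2$ and $|x|=\sqrt{3}$.
   Context: The Legendre polynomial of degree $n\geq0$ is $$P_n(x)=\frac{1}{2^n}\sum_{k=0}^n\binom{n}{k}^2(x-1)^{n-k}(x+1)^k.$$ $P_n^2(x)$ means $(P_n(x))^2$. *)

(* Defs.v *)
From mathcomp Require Import all_boot all_order all_algebra.
From mathcomp Require Import reals.

Set Implicit Arguments.
Unset Strict Implicit.
Unset Printing Implicit Defensive.

Import Order.TTheory GRing.Theory Num.Theory.
Local Open Scope ring_scope.

Definition legendre (R : realType) (n : nat) : {poly R} :=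
  (2 ^+ n)^-1 *: \sum_(0 <= k < n.+1)
     (('C(n, k) ^ 2)%N)%:R *: (('X - 1) ^+ (n - k) * ('X + 1) ^+ k).

(* Main.v *)
Require Import Defs.
From mathcomp Require Import all_boot all_order all_algebra.
From mathcomp Require Import reals.
From mathcomp Require Import ring lra.

Set Implicit Arguments.
Unset Strict Implicit.
Unset Printing Implicit Defensive.

Import Order.TTheory GRing.Theory Num.Theory.
Local Open Scope ring_scope.

(** The inequality says that the Turan gap
      U_n = (n+1)^2 P_n^2 - n (n+2) P_{n-1} P_{n+1}
    is nonnegative when [|x| > 1], and strictly positive unless it is
    U_2 = (x^2 - 3)^2 / 4 with [x^2 = 3].  For n >= 3 positivity is proved by
    induction starting from U_2 >= 0.

    Write m = n+1 and a, p, b, c for P_{m-2}, P_{m-1}, P_m, P_{m+1}.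
    Eliminating x and c with two instances of the three-term recurrence turns
    U_m into a quadratic form in a, p, b.  The hypothesis U_{m-1} >= 0 alone
    does not make this form positive: for x close to 1 the induction step
    needs a second lower bound.  It is supplied by
      K_n = (2n+1) P_n^2 - 2n P_{n-1} P_{n+1} - P_{n-1}^2 >= 0,
    which holds for every real x, because K_1 = 0 and K_{n+1} is a positive
    multiple of K_n + (P_{n+1} - P_{n-1})^2 ([turan_defect_ge0]).
    With both bounds the step is the identity
      (2m-1)(m+1)(m-1) m^2 U_m
        = m^2 (m+2)(2m-1)(m-2) U_{m-1} + m^4 (m+2) K_{m-1}
          + (m+2)(m^2 a - (m-1)^2 b)^2 + (m-1)(2m-1)(m-2) b^2,
    whose last term is positive for m >= 3 as soon as P_m(x) is not zero
    ([turan_gap_step]).  The condition [|x| > 1] enters by excluding zeros: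
    there the recurrence makes [|P_n(x)|] nondecreasing in n, starting from
    P_0 = 1 ([legendre_neq0]).

    The recurrence itself is derived from the defining sum by factoring out a
    power of (x-1)/2: what remains is the polynomial with coefficients
    binomial(n,k)^2, evaluated at (x+1)/(x-1), and the recurrence becomes an
    identity between squares of binomial coefficients ([sqbin_recurrence]). *)

(** * The three-term recurrence *)

Definition sqbin_poly (R : comNzRingType) (n : nat) : {poly R} :=
  \poly_(k < n.+1) (('C(n, k))%:R ^+ 2).

Lemma coef_sqbin (R : comNzRingType) n k :
  (sqbin_poly R n)`_k = ('C(n, k))%:R ^+ 2.
Proof.
rewrite coef_poly ltnS; case: leqP => // lt_nk.
by rewrite bin_small // expr0n.
Qed.

(** With the subtraction taken in the ring, the relation needs no bound on
    [k], so that [sqbin_recurrence] compares all coefficients uniformly. *)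
Lemma natr_mul_bin_left (R : comNzRingType) n k :
  k.+1%:R * ('C(n, k.+1))%:R = (n%:R - k%:R) * ('C(n, k))%:R :> R.
Proof.
have [le_kn | lt_nk] := leqP k n; last first.
  by rewrite !bin_small ?mulr0 // ltnW.
by rewrite -natrB // -!natrM mul_bin_left.
Qed.

(** This is (n+2) S_{n+2} = (2n+3) (u+v) S_{n+1} - (n+1) (u-v)^2 S_n for
    S_n = sum_k binomial(n,k)^2 u^{n-k} v^k, dehomogenized at u = 1, v = 'X.
    For u = x-1 and v = x+1 one has u+v = 2x and (u-v)^2 = 4, which gives the
    recurrence of the Legendre polynomials. *)
Lemma sqbin_recurrence (R : comNzRingType) n :
  n.+2%:R *: sqbin_poly R n.+2 =
  (2 * n%:R + 3) *: (sqbin_poly R n.+1 + sqbin_poly R n.+1 * 'X)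
  - n.+1%:R *: (sqbin_poly R n - 2 *: (sqbin_poly R n * 'X)
                + sqbin_poly R n * 'X * 'X).
Proof.
apply/polyP=> -[|[|k]];
  rewrite !(coefZ, coefB, coefD, coefMX, coef_sqbin) /=.
- by rewrite !bin0 -!natr1; ring.
- rewrite !bin0 !bin1 -!natr1; ring.
rewrite !binS !natrD.
have e1 := natr_mul_bin_left R n k.
have e2 := natr_mul_bin_left R n k.+1.
move: e1 e2; rewrite -!natr1.
set A := ('C(n, k))%:R; set B := ('C(n, k.+1))%:R; set D := ('C(n, k.+2))%:R.
set N : R := n%:R; set K : R := k%:R => e1 e2.
apply/eqP; rewrite -subr_eq0; apply/eqP.
(* By Pascal's rule all binomials reduce to A, B, D; the claim then lies in
   the ideal generated by the two contiguity relations e1 and e2. *)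
transitivity (2 * ((K + 1 + 1) * D - (N - (K + 1)) * B) * (A + B)
  - 2 * ((K + 1) * B - (N - K) * A) * (B + D)); first by ring.
by rewrite e1 e2; ring.
Qed.

Lemma legendre_sqbin (R : realType) n (x : R) : x != 1 ->
  (legendre R n).[x]
    = ((x - 1) / 2) ^+ n * (sqbin_poly R n).[(x + 1) / (x - 1)].
Proof.
rewrite -subr_eq0 => x1.
rewrite /legendre hornerZ horner_sum horner_poly big_mkord expr_div_n.
rewrite [_ ^+ n / _]mulrC -mulrA; congr (_ * _); rewrite mulr_sumr.
apply: eq_bigr => k _.
have kn : (k <= n)%N by rewrite -ltnS.
have -> : (x - 1) ^+ n = (x - 1) ^+ (n - k) * (x - 1) ^+ k.
  by rewrite -exprD subnK.
rewrite hornerZ hornerM !horner_exp !hornerD hornerN hornerX hornerC.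
by rewrite natrX expr_div_n; field; rewrite expf_neq0.
Qed.

(** The rest of the argument uses nothing about the values P_n(x) beyond this
    recurrence. *)
Definition legendre_recurrence (F : realFieldType) (x : F) (P : nat -> F) :=
  [/\ P 0%N = 1, P 1%N = x
    & forall n, n.+2%:R * P n.+2
        = (2 * n%:R + 3) * x * P n.+1 - n.+1%:R * P n].

Lemma legendreP (R : realType) (x : R) : x != 1 ->
  legendre_recurrence x (fun n => (legendre R n).[x]).
Proof.
move=> x1; have u0 : x - 1 != 0 by rewrite subr_eq0.
split=> [||n]; rewrite !legendre_sqbin //.
- by rewrite expr0 mul1r horner_poly big_ord1 bin0 expr0 !expr1n mul1r.
- rewrite horner_poly !big_ord_recl big_ord0 /= bin0 binn; field.
  exact: u0.
have /(congr1 (fun p : {poly R} => p.[(x + 1) / (x - 1)])) :=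
  sqbin_recurrence R n.
rewrite !(hornerZ, hornerD, hornerN, hornerM, hornerX) => e.
rewrite mulrCA e !exprS; field.
exact: u0.
Qed.

(** * Nonvanishing and an auxiliary bound *)

(** The recurrence yields
    (n+2) |P_{n+2}| >= (2n+3) |P_{n+1}| - (n+1) |P_n| when [1 <= |x|], hence
    |P_{n+2}| >= |P_{n+1}| whenever |P_{n+1}| >= |P_n|. *)
Lemma legendre_neq0 (F : realFieldType) (x : F) P : 1 <= `|x| ->
  legendre_recurrence x P -> forall n, P n != 0.
Proof.
move=> hx [P0 P1 rec].
suff h n : 0 < `|P n| <= `|P n.+1|.
  by move=> n; rewrite -normr_gt0; case/andP: (h n).
elim: n => [|n /andP[p0 ple]]; first by rewrite P0 P1 normr1 ltr01.
rewrite (lt_le_trans p0 ple) /=.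
have n2 : 0 < n.+2%:R :> F by rewrite ltr0n.
rewrite -(ler_pM2l n2) -[X in X * `|P n.+2|](gtr0_norm n2) -normrM rec.
apply: le_trans (lerB_dist _ _); rewrite !normrM normr_nat.
have n0 : 0 <= n%:R :> F by rewrite ler0n.
rewrite [`|2 * _ + _|]ger0_norm; last by lra.
have h1 : 0 <= (2 * n%:R + 3) * (`|x| - 1) * `|P n.+1|.
  by rewrite !mulr_ge0 //; lra.
have h2 : 0 <= (n%:R + 1) * (`|P n.+1| - `|P n|) by apply: mulr_ge0; lra.
by rewrite -!natr1; lra.
Qed.

(** K_{n+1} >= 0 in the notation above.  Eliminating x and P_{n+3} with the
    recurrence gives
    (n+3)(2n+3) K_{n+2} = (n+1)(2n+5) (K_{n+1} + (P_{n+2} - P_n)^2), so the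
    defect is a sum of squares with positive weights. *)
Lemma turan_defect_ge0 (F : realFieldType) (x : F) P :
  legendre_recurrence x P -> forall n,
  0 <= (2 * n%:R + 3) * P n.+1 ^+ 2 - 2 * n.+1%:R * (P n * P n.+2) - P n ^+ 2.
Proof.
move=> [P0 P1 rec]; elim=> [|n IH].
  by have := rec 0%N; rewrite P0 P1 => e; rewrite (_ : _ - _ = 0) //; lra.
have n0 : 0 <= n%:R :> F by rewrite ler0n.
move: IH (rec n) (rec n.+1); rewrite -!natr1.
set a := P n; set p := P n.+1; set b := P n.+2; set c := P n.+3.
set N : F := n%:R => IH e1 e2.
set K := (X in 0 <= X) in IH; set K' := (X in 0 <= X).
have key : (N + 3) * (2 * N + 3) * K'
  = (N + 1) * (2 * N + 5) * (K + (b - a) ^+ 2).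
  apply/eqP; rewrite -subr_eq0; apply/eqP.
  transitivity (- 2 * (N + 2) * (2 * N + 3) * p *
      ((N + 3) * c - ((2 * N + 5) * x * b - (N + 2) * p))
    + 2 * (N + 2) * (2 * N + 5) * b
      * ((N + 2) * b - ((2 * N + 3) * x * p - (N + 1) * a))).
    by rewrite /K' /K; ring.
  have -> : (N + 3) * c = (2 * N + 5) * x * b - (N + 2) * p by lra.
  have -> : (N + 2) * b = (2 * N + 3) * x * p - (N + 1) * a by lra.
  by ring.
rewrite -(@pmulr_rge0 _ ((N + 3) * (2 * N + 3))); last by nra.
rewrite key; apply: mulr_ge0; first by nra.
by apply: addr_ge0 => //; apply: sqr_ge0.
Qed.

(** * The Turan gap *)

(** The index is shifted to avoid predecessors: this is U_{n+1}. *)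
Definition turan_gap (F : realFieldType) (P : nat -> F) (n : nat) :=
  n.+2%:R ^+ 2 * P n.+1 ^+ 2 - n.+1%:R * n.+3%:R * (P n * P n.+2).

Lemma turan_gap2 (F : realFieldType) (x : F) P : legendre_recurrence x P ->
  turan_gap P 1 = ((x ^+ 2 - 3) / 2) ^+ 2.
Proof.
move=> [P0 P1 rec]; move: (rec 0%N) (rec 1%N); rewrite /turan_gap P0 P1 => e e'.
have P2 : P 2 = (3 * x ^+ 2 - 1) / 2 by lra.
have P3 : P 3 = (5 * x * P 2 - 2 * x) / 3 by lra.
by rewrite P3 P2; field.
Qed.

(** The weights of U_{m-1} and K_{m-1} in the identity are chosen so that p^2
    cancels and the remaining form in a and b is positive definite for m > 2,
    its discriminant being a positive multiple of - (2m-1)(m-2). *)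
Lemma turan_gap_step (F : realFieldType) (x : F) P n : P n.+3 != 0 ->
  legendre_recurrence x P -> 0 <= turan_gap P n.+1 -> 0 < turan_gap P n.+2.
Proof.
move=> b0 Pr; have := turan_defect_ge0 Pr n.+1.
have [_ _ rec] := Pr; have n0 : 0 <= n%:R :> F by rewrite ler0n.
move: b0 (rec n.+1) (rec n.+2); rewrite /turan_gap -!natr1.
set a := P n.+1; set p := P n.+2; set b := P n.+3; set c := P n.+4.
set m : F := n%:R + 3 => b0 e1 e2.
set K := (X in 0 <= X) => K0; set U := (X in 0 <= X) => U0.
set V := (X in 0 < X).
have m3 : 3 <= m by rewrite /m; lra.
have key : (2 * m - 1) * (m + 1) * (m - 1) * m ^+ 2 * V
  = m ^+ 2 * (m + 2) * (2 * m - 1) * (m - 2) * U + m ^+ 4 * (m + 2) * K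
    + (m + 2) * (m ^+ 2 * a - (m - 1) ^+ 2 * b) ^+ 2
    + (m - 1) * (2 * m - 1) * (m - 2) * b ^+ 2.
  apply/eqP; rewrite -subr_eq0; apply/eqP.
  transitivity (- (2 * m - 1) * (m - 1) * m ^+ 3 * (m + 2) * p *
      ((m + 1) * c - ((2 * m + 1) * x * b - m * p))
    + (m - 1) * m ^+ 3 * (m + 2) * (2 * m + 1) * b
      * (m * b - ((2 * m - 1) * x * p - (m - 1) * a))).
    by rewrite /V /U /K /m; ring.
  have -> : (m + 1) * c = (2 * m + 1) * x * b - m * p by rewrite /m; lra.
  have -> : m * b = (2 * m - 1) * x * p - (m - 1) * a by rewrite /m; lra.
  by ring.
have b2 : 0 < b ^+ 2 by rewrite exprn_even_gt0.
have c0 : 0 < (2 * m - 1) * (m + 1) * (m - 1) * m ^+ 2.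
  by rewrite !mulr_gt0 ?exprn_gt0 //; lra.
rewrite -(pmulr_rgt0 _ c0) key; apply: ltr_wpDl; last first.
  by apply: mulr_gt0 => //; rewrite !mulr_gt0 //; lra.
apply: addr_ge0; last by apply: mulr_ge0 (sqr_ge0 _); lra.
apply: addr_ge0; first by rewrite !mulr_ge0 ?exprn_ge0 //; lra.
by rewrite !mulr_ge0 ?exprn_ge0 //; lra.
Qed.

Lemma turan_gap_gt0 (F : realFieldType) (x : F) P : 1 <= `|x| ->
  legendre_recurrence x P -> forall n, 0 < turan_gap P n.+2.
Proof.
move=> hx Pr; have P0 := legendre_neq0 hx Pr.
elim=> [|n IH]; last exact: turan_gap_step (P0 _) Pr (ltW IH).
by apply: (turan_gap_step (P0 _) Pr); rewrite (turan_gap2 Pr) sqr_ge0.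
Qed.

Theorem theorem3 (R : realType) (n : nat) (x : R)
    (hn : (2 <= n)%N) (hx : 1 < `|x|) :
  (legendre R n.-1).[x] * (legendre R n.+1).[x] / (legendre R n).[x] ^+ 2
    <= n.+1%:R ^+ 2 / (n%:R * n.+2%:R)
  /\
  ((legendre R n.-1).[x] * (legendre R n.+1).[x] / (legendre R n).[x] ^+ 2
     = n.+1%:R ^+ 2 / (n%:R * n.+2%:R)
   <-> n = 2%N /\ `|x| = Num.sqrt 3).
Proof.
have x1 : x != 1 by apply: contraTneq hx => ->; rewrite normr1 ltxx.
have Pr := legendreP x1; have P0 := legendre_neq0 (ltW hx) Pr.
case: n hn => [//|[//|n]] _ /=.
have p2 : 0 < (legendre R n.+2).[x] ^+ 2 by rewrite exprn_even_gt0 // P0.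
have q0 : 0 < n.+2%:R * n.+4%:R :> R by rewrite -natrM ltr0n.
set ab := _ * _.[x].
have gapE : turan_gap (fun k => (legendre R k).[x]) n.+1
  = n.+3%:R ^+ 2 * (legendre R n.+2).[x] ^+ 2 - n.+2%:R * n.+4%:R * ab by [].
have leE : (ab / (legendre R n.+2).[x] ^+ 2
      <= n.+3%:R ^+ 2 / (n.+2%:R * n.+4%:R))
    = (0 <= turan_gap (fun k => (legendre R k).[x]) n.+1).
  by rewrite ler_pdivrMr // mulrAC ler_pdivlMr // gapE subr_ge0 mulrC.
have eqE : (ab / (legendre R n.+2).[x] ^+ 2
      == n.+3%:R ^+ 2 / (n.+2%:R * n.+4%:R))
    = (turan_gap (fun k => (legendre R k).[x]) n.+1 == 0).
  rewrite eqr_div ?(gt_eqF p2) ?(gt_eqF q0) // gapE subr_eq0 eq_sym.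
  by rewrite [ab * _]mulrC.
rewrite leE /ab; case: n @ab {gapE leE} p2 q0 eqE => [|n] ab p2 q0 eqE; last first.
  have gap0 := turan_gap_gt0 (ltW hx) Pr n.
  split; first exact: ltW.
  by split=> [/eqP|[]//]; rewrite eqE gt_eqF.
have gap2 := turan_gap2 Pr; split; first by rewrite gap2 sqr_ge0.
have -> : (`|x| = Num.sqrt 3) <-> x ^+ 2 = 3.
  split=> [e|<-]; last by rewrite sqrtr_sqr.
  by rewrite -real_normK ?num_real // e sqr_sqrtr.
split=> [/eqP|[_ e]]; last apply/eqP; rewrite eqE gap2.
  rewrite sqrf_eq0 mulf_eq0 invr_eq0 pnatr_eq0 orbF subr_eq0.
  by move/eqP.
by rewrite e subrr mul0r expr0n.
Qed.
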